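(* If for some $k$, $\Lambda$ admits $k$-bounded one-step wsi models (every conjunctive one-step $\Lambda$-formula has a one-step wsi model $(X,\tau,t)$ with $|\breve\tau(x)|\le k$ for all $x\in X$), then every conjunctive $\Lambda$-$\nu$-sentence has a wsi model whose size is polynomial in the size of the sentence.
   Context: Fix an endofunctor $T$ on sets, non-trivial and preserving subsets. $\Lambda$ is a set of modal operators $\heartsuit$ (unary; atomic propositions nullary), each with a monotone natural predicate lifting $[\![\heartsuit]\!]_X:\mathcal P(X)\to\mathcal P(TX)$; $t\models\heartsuit A$ means $t\in[\![\heartsuit]\!]_X(A)$. Models are $T$-coalgebras $(X,\xi)$. A $\Lambda$-simulation of $(X,\xi)$ by $(Y,\zeta)$ is $S\subseteq X\times Y$ with: $xSy$ and $\xi(x)\models\heartsuit A$ imply $\zeta(y)\models\heartsuit S[A]$, $S[A]=\{y:\exists x\in A.\,xSy\}$. Over a set $\Delta$ of fixpoint variables, conjunctive $\Lambda$-$\nu$-formulas are built from $\top$, $\wedge$, $\heartsuit\phi$ ($\heartsuit\in\Lambda$), variables $y\in\Delta$, and $\nu(y_0;y_1,\dots,y_n).(\phi_0;\dots,\phi_n)$ (distinct $y_i$); a sentence has no free variables. Semantics over $C=(X,\xi)$ and $\mathcal V:\Delta\to\mathcal P(X)$: variables by $\mathcal V$, $x\in[\![\heartsuit\phi]\!]$ iff $\xi(x)\models\heartsuit[\![\phi]\!]$, and $[\![\nu(y_0;\dots,y_n).(\phi_0;\dots,\phi_n)]\!]_{C,\mathcal V}$ is the first component of the greatest fixpoint of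 $(A_0,\dots,A_n)\mapsto([\![\phi_i]\!]_{C,\mathcal V[y_0\mapsto A_0,\dots,y_n\mapsto A_n]})_{i=0..n}$. A pointed model $(C,r)$ is wsi for a sentence $\phi$ if for every pointed model $(D,y)$: $y\models_D\phi$ iff $rSy$ for some $\Lambda$-simulation $S$ of $C$ by $D$. One-step notions: a one-step model over $V$ is $(X,\tau,t)$ with $\tau:V\to\mathcal P(X)$, $t\in TX$, $\breve\tau(x)=\{p:x\in\tau(p)\}$; a conjunctive one-step formula is a finite conjunction of atoms $\heartsuit p$, satisfied iff $t\models\heartsuit\tau(p)$ for each atom. $(X,\tau,t)$ is one-step wsi for such $\psi$ if it satisfies $\psi$ and for every one-step model $(Y,\theta,s)\models\psi$, $A\subseteq X$, $\heartsuit\in\Lambda$: $t\models\heartsuit A$ implies $s\models\heartsuit S[A]$, where $xSy$ iff $\breve\tau(x)\subseteq\breve\theta(y)$. *)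

(* Defs.v *)
From HB Require Import structures.
From mathcomp Require Import all_boot all_order all_algebra.
From mathcomp Require Import boolp classical_sets functions cardinality.

Set Implicit Arguments.
Unset Strict Implicit.
Unset Printing Implicit Defensive.

Local Open Scope classical_set_scope.

Record set_functor := SetFunctor {
  fobj :> Type -> Type;
  fmap : forall X Y : Type, (X -> Y) -> fobj X -> fobj Y;
  fmap_id : forall X : Type, fmap (@id X) = id;
  fmap_comp : forall (X Y Z : Type) (g : Y -> Z) (f : X -> Y),
    fmap (g \o f) = fmap g \o fmap f
}.

Arguments fmap T {X Y} f t : rename.

Definition nontrivial (T : set_functor) : Prop :=
  forall X : Type, ~ inhabited (T X) -> ~ inhabited X.

(* T A is a subset of T X via the image of the inclusion of A into X. *)
Definition preserves_subsets (T : set_functor) : Prop :=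
  forall (X : Type) (A : set X),
    injective (fmap T (@proj1_sig X A)).

(* Nullary operators (atomic propositions) are kept as a separate sort. *)
Record modal_signature (T : set_functor) := ModalSignature {
  modality : Type;
  lifting : modality -> forall X : Type, set X -> set (T X);
  lifting_monotone : forall (h : modality) (X : Type) (A B : set X),
    A `<=` B -> lifting h A `<=` lifting h B;
  lifting_natural : forall (h : modality) (X Y : Type) (f : X -> Y) (B : set Y),
    lifting h (f @^-1` B) = fmap T f @^-1` lifting h B;
  proposition : Type;
  prop_lifting : proposition -> forall X : Type, set (T X);
  prop_lifting_natural : forall (a : proposition) (X Y : Type) (f : X -> Y),
    @prop_lifting a X = fmap T f @^-1` @prop_lifting a Y
}.

Arguments lifting {T L} h {X} A : rename.
Arguments prop_lifting {T L} a X : rename.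

Record coalgebra (T : set_functor) := Coalgebra {
  state :> Type;
  transition : state -> T state
}.

Definition rel_image (X Y : Type) (S : X -> Y -> Prop) (A : set X) : set Y :=
  [set y | exists2 x, A x & S x y].

Definition simulation (T : set_functor) (L : modal_signature T)
    (C D : coalgebra T) (S : C -> D -> Prop) : Prop :=
  forall (x : C) (y : D), S x y ->
    (forall (h : modality L) (A : set C),
       lifting h A (transition x) -> lifting h (rel_image S A) (transition y)) /\
    (forall a : proposition L,
       prop_lifting a C (transition x) -> prop_lifting a D (transition y)).

Inductive formula (T : set_functor) (L : modal_signature T) (Delta : eqType) :=
| Top
| And of formula L Delta & formula L Delta
| Prp of proposition L
| Mod of modality L & formula L Delta
| Var of Delta
(* nu (y 0; y 1, ..., y n) . (phi 0; phi 1, ..., phi n) *)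
| Nu (n : nat) (y : 'I_n.+1 -> Delta) (y_inj : injective y)
     (phi : 'I_n.+1 -> formula L Delta).

Arguments Top {T L Delta}.
Arguments Prp {T L Delta} a : rename.
Arguments Var {T L Delta} y : rename.
Arguments Nu {T L Delta n} [y] y_inj phi.

Section Formulas.
Variables (T : set_functor) (L : modal_signature T) (Delta : eqType).

Fixpoint free_vars (f : formula L Delta) : set Delta :=
  match f with
  | Top => set0
  | And f1 f2 => free_vars f1 `|` free_vars f2
  | Prp _ => set0
  | Mod _ f1 => free_vars f1
  | Var y => [set y]
  | Nu n y _ phi => (\bigcup_(i : 'I_n.+1) free_vars (phi i)) `\` range y
  end.

Definition sentence (f : formula L Delta) : Prop := free_vars f = set0.

(* Number of symbol occurrences; nu-bound variables count at their binder. *)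
Fixpoint fsize (f : formula L Delta) : nat :=
  match f with
  | Top => 1
  | And f1 f2 => (fsize f1 + fsize f2).+1
  | Prp _ => 1
  | Mod _ f1 => (fsize f1).+1
  | Var _ => 1
  | Nu n _ _ phi => (\sum_(i < n.+1) (fsize (phi i)).+1).+1
  end.

Definition update (X : Type) (V : Delta -> set X) (n : nat)
    (y : 'I_n -> Delta) (A : 'I_n -> set X) : Delta -> set X :=
  fun z => if [pick i | y i == z] is Some i then A i else V z.

Definition family_le (X : Type) (n : nat) (A B : 'I_n -> set X) : Prop :=
  forall i, A i `<=` B i.

Definition is_gfp (X : Type) (n : nat)
    (F : ('I_n -> set X) -> 'I_n -> set X) (A : 'I_n -> set X) : Prop :=
  F A = A /\ forall B, F B = B -> family_le B A.

(* The greatest fixpoint of F if there is one, as for all monotone F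
   (see gfpP), and the empty family otherwise. *)
Definition gfp (X : Type) (n : nat)
    (F : ('I_n -> set X) -> 'I_n -> set X) : 'I_n -> set X :=
  fun i => [set x | exists2 A, is_gfp F A & A i x].

Fixpoint sem (C : coalgebra T) (V : Delta -> set C) (f : formula L Delta) :
    set C :=
  match f with
  | Top => setT
  | And f1 f2 => sem V f1 `&` sem V f2
  | Prp a => [set x | prop_lifting a C (transition x)]
  | Mod h f1 => [set x | lifting h (sem V f1) (transition x)]
  | Var y => V y
  | Nu n y _ phi => gfp (fun A i => sem (update V y A) (phi i)) ord0
  end.

(* For sentences the choice of valuation is immaterial (see sem_sentence). *)
Definition satisfies (C : coalgebra T) (x : C) (f : formula L Delta) : Prop :=
  sem (fun=> set0) f x.

Definition wsi (C : coalgebra T) (r : C) (f : formula L Delta) : Prop :=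
  forall (D : coalgebra T) (y : D),
    satisfies y f <->
    exists S : C -> D -> Prop, simulation L S /\ S r y.

Lemma gfpP (X : Type) (n : nat) (F : ('I_n -> set X) -> 'I_n -> set X) :
  (forall A B, family_le A B -> family_le (F A) (F B)) ->
  is_gfp F (gfp F) /\ forall A, family_le A (F A) -> family_le A (gfp F).
Proof.
move=> mF; pose U i := [set x | exists2 A, family_le A (F A) & A i x].
have UF : family_le U (F U).
  by move=> i x [A AF Aix]; apply: (mF A U) (AF i x Aix) => j z Ajz; exists A.
have FU : family_le (F U) U by move=> i x FUx; exists (F U) => //; apply: mF.
have gU : is_gfp F U.
  split=> [|B FB i x Bx]; first by apply/funext => i; apply/seteqP; split.
  by exists B => //; rewrite FB => j.
suff -> : gfp F = U by split=> // A AF i x Ax; exists A.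
apply/funext => i; apply/seteqP; split=> x; last by exists U.
by move=> [A [FA _] Ax]; apply: gU.2 Ax.
Qed.

Lemma update_le (X : Type) (V W : Delta -> set X) n (y : 'I_n -> Delta) A B z :
  (~ range y z -> V z `<=` W z) -> family_le A B ->
  update V y A z `<=` update W y B z.
Proof.
move=> VW AB; rewrite /update; case: pickP => [i _|yz]; first exact: AB.
by apply: VW => -[i _ /eqP]; rewrite yz.
Qed.

Lemma sem_le (C : coalgebra T) (f : formula L Delta) (V W : Delta -> set C) :
  (forall z, free_vars f z -> V z `<=` W z) -> sem V f `<=` sem W f.
Proof.
elim: f V W => [|f IHf g IHg|a|h f IHf|y|n y yi phi IH] V W VW //=.
- apply: setISS; [apply: IHf|apply: IHg] => z zf; apply: VW; [by left|by right].
- by move=> x; apply: lifting_monotone; apply: IHf.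
- exact: VW.
- have mono (U : Delta -> set C) A B : family_le A B ->
      family_le (fun i => sem (update U y A) (phi i))
                (fun i => sem (update U y B) (phi i)).
    by move=> AB i; apply: IH => z _; apply: update_le => // _.
  have [[FV _] _] := gfpP (mono V).
  have [_ maxW] := gfpP (mono W).
  apply: maxW => i; rewrite -[X in X i `<=` _]FV; apply: IH => z zi.
  by apply: update_le => [yz|j //]; apply: VW; split=> //; exists i.
Qed.

Lemma sem_nu (C : coalgebra T) (V : Delta -> set C) n (y : 'I_n.+1 -> Delta)
    (phi : 'I_n.+1 -> formula L Delta) :
  let F A i := sem (update V y A) (phi i) in is_gfp F (gfp F).
Proof.
move=> F; apply: (proj1 (gfpP _)) => A B AB i.
by apply: sem_le => z _; apply: update_le => // _.
Qed.

Lemma sem_sentence (C : coalgebra T) (f : formula L Delta)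
    (V W : Delta -> set C) :
  sentence f -> sem V f = sem W f.
Proof. by move=> f0; apply/seteqP; split; apply: sem_le => z; rewrite f0. Qed.

End Formulas.

Section OneStep.
Variables (T : set_functor) (L : modal_signature T) (V : Type).

Inductive one_step_atom :=
| OSPrp of proposition L
| OSMod of modality L & V.

(* The conjunction of the listed atoms. *)
Definition one_step_formula := seq one_step_atom.

Record one_step_model := OneStepModel {
  os_carrier :> Type;
  os_val : V -> set os_carrier;
  os_elt : T os_carrier
}.

Definition os_type (M : one_step_model) (x : M) : set V :=
  [set p | os_val p x].

Definition os_sat_atom (M : one_step_model) (a : one_step_atom) : Prop :=
  match a with
  | OSPrp q => prop_lifting q M (os_elt M)
  | OSMod h p => lifting h (os_val (o := M) p) (os_elt M)
  end.

Definition os_sat (M : one_step_model) (psi : one_step_formula) : Prop :=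
  foldr (fun a P => os_sat_atom M a /\ P) True psi.

Definition one_step_wsi (M : one_step_model) (psi : one_step_formula) : Prop :=
  os_sat M psi /\
  forall N : one_step_model, os_sat N psi ->
    (forall (h : modality L) (A : set M),
       lifting h A (os_elt M) ->
       lifting h (rel_image (fun (x : M) (y : N) => os_type x `<=` os_type y) A)
         (os_elt N)) /\
    (forall q : proposition L,
       prop_lifting q M (os_elt M) -> prop_lifting q N (os_elt N)).

End OneStep.

Definition admits_bounded_one_step_wsi (T : set_functor)
    (L : modal_signature T) (k : nat) : Prop :=
  forall (V : Type) (psi : one_step_formula L V),
    exists M : one_step_model T V,
      one_step_wsi M psi /\ forall x : M, (os_type x #<= `I_k)%card.

(* Main.v *)
(** A sentence is compiled into a finite system of equations, one variable per
    symbol occurrence; a variable bound by a fixpoint operator becomes a link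
    to the corresponding body. Closing a set of nodes under the links (which
    also removes unguardedness) yields a conjunctive one-step formula over the
    nodes. The wsi model has as states the sets of at most [k + 1] nodes: the
    transition of a state is the image, under the map sending a point to its
    type, of the [k]-bounded one-step wsi model of the formula of that state.
    Simulations of this model and post-fixpoints of the system correspond to
    each other, and the number of states is polynomial since [k] is fixed. *)

Require Import Defs.
From mathcomp Require Import all_boot all_order all_algebra.
From mathcomp Require Import boolp classical_sets functions cardinality.

Local Open Scope classical_set_scope.

Set Implicit Arguments.
Unset Strict Implicit.
Unset Printing Implicit Defensive.

(** * Equation systems *)

Section Systems.
Variables (T : set_functor) (L : modal_signature T) (Delta : eqType).

(** Right-hand sides of equations. [Conj] serves for truth (empty list), links (singletons) and
    conjunctions; [Free] marks a variable not bound so far. *)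
Inductive label (P : eqType) :=
| Conj of seq P
| Atom of one_step_atom L P
| Free of Delta.

Arguments Free {P}.

Definition map_atom (P Q : Type) (f : P -> Q) (a : one_step_atom L P) :
    one_step_atom L Q :=
  match a with
  | OSPrp q => OSPrp Q q
  | OSMod h p => OSMod h (f p)
  end.

(* Maps nodes by [f] and replaces the free variables in the domain of [b] by
   links. *)
Definition map_label (P Q : eqType) (f : P -> Q) (b : Delta -> option Q)
    (l : label P) : label Q :=
  match l with
  | Conj s => Conj [seq f p | p <- s]
  | Atom a => Atom (map_atom f a)
  | Free z => if b z is Some q then Conj [:: q] else Free z
  end.

Section Semantics.
Variables (C : coalgebra T) (V : Delta -> set C).

Definition label_sem (P : eqType) (X : P -> set C) (l : label P) : set C :=
  match l with
  | Conj s => [set x | forall p, p \in s -> X p x]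
  | Atom a => [set x | os_sat_atom (OneStepModel X (transition x)) a]
  | Free z => V z
  end.

Definition post (P : eqType) (eqs : P -> label P) (X : P -> set C) : Prop :=
  forall p, X p `<=` label_sem X (eqs p).

(** The greatest fixpoint in Knaster-Tarski form, as the union of all post-fixpoints. *)
Definition solution (P : eqType) (eqs : P -> label P) (p : P) : set C :=
  [set x | exists2 X, post eqs X & X p x].

Lemma os_sat_atom_le (P : Type) (X Y : P -> set C) (t : T C)
    (a : one_step_atom L P) : (forall p, X p `<=` Y p) ->
  os_sat_atom (OneStepModel X t) a -> os_sat_atom (OneStepModel Y t) a.
Proof. by case: a => [q|h p] //= XY; apply/lifting_monotone/XY. Qed.

Lemma label_sem_le (P : eqType) (X Y : P -> set C) (l : label P) :
  (forall p, X p `<=` Y p) -> label_sem X l `<=` label_sem Y l.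
Proof.
case: l => [s|a|z] XY x //=; last exact: os_sat_atom_le.
by move=> Xs p /Xs; apply: XY.
Qed.

Lemma post_solution (P : eqType) (eqs : P -> label P) :
  post eqs (solution eqs).
Proof.
by move=> p x [X pX /pX]; apply: label_sem_le => q z Xz; exists X.
Qed.

Lemma solution_unfold (P : eqType) (eqs : P -> label P) (p : P) :
  solution eqs p = label_sem (solution eqs) (eqs p).
Proof.
apply/seteqP; split; first exact: post_solution.
move=> x px; exists (fun q => label_sem (solution eqs) (eqs q)) => // q.
by apply: label_sem_le; apply: post_solution.
Qed.

End Semantics.

Lemma label_sem_map (C : coalgebra T) (V W : Delta -> set C) (P Q : eqType)
    (f : P -> Q) (b : Delta -> option Q) (X : Q -> set C) (l : label P) :
  (forall z, W z = if b z is Some q then X q else V z) ->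
  label_sem V X (map_label f b l) = label_sem W (X \o f) l.
Proof.
case: l => [s|[q|h p]|z] VW //=.
  apply/seteqP; split=> x Xs p; first by move=> ps; apply: Xs; apply: map_f.
  by case/mapP=> q qs ->; apply: Xs.
rewrite VW; case: (b z) => [q|] //=; apply/seteqP; split=> x /=.
  by apply; rewrite mem_head.
by move=> Xx p; rewrite inE => /eqP ->.
Qed.

(** The image of [f] is closed under the equations of [eQ], so the other nodes do not matter:
    post-fixpoints restrict along [f], and extend by unions over its fibres. *)
Lemma solution_embed (C : coalgebra T) (V : Delta -> set C) (P Q : eqType)
    (f : P -> Q) (eP : P -> label P) (eQ : Q -> label Q) :
  (forall p, eQ (f p) = map_label f (fun=> None) (eP p)) ->
  forall p, solution V eQ (f p) = solution V eP p.
Proof.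
move=> eQf p; apply/seteqP; split=> x [X pX Xx].
  exists (X \o f) => // q y /pX.
  by rewrite eQf (label_sem_map (W := V)).
exists (fun q => [set y | exists2 p', f p' = q & X p' y]); last by exists p.
move=> _ y [q <- /pX].
rewrite eQf (label_sem_map (W := V)) //.
by apply: label_sem_le => p' z; exists p'.
Qed.

(** * Compilation of formulas into finite systems *)

Record system := System {
  node : finType;
  root : node;
  equation : node -> label node
}.

Definition single_system (l : label unit) : system :=
  @System unit tt (fun=> l).

Definition and_equation (s t : system) (p : option (node s + node t)) :
    label (option (node s + node t)) :=
  match p with
  | None => Conj [:: Some (inl (root s)); Some (inr (root t))]
  | Some (inl q) => map_label (Some \o inl) (fun=> None) (equation q)
  | Some (inr q) => map_label (Some \o inr) (fun=> None) (equation q)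
  end.

Definition and_system (s t : system) : system :=
  @System (option (node s + node t)) None (@and_equation s t).

Definition mod_equation (h : modality L) (s : system) (p : option (node s)) :
    label (option (node s)) :=
  match p with
  | None => Atom (OSMod h (Some (root s)))
  | Some q => map_label Some (fun=> None) (equation q)
  end.

Definition mod_system (h : modality L) (s : system) : system :=
  @System (option (node s)) None (@mod_equation h s).

Section NuSystem.
Variables (n : nat) (y : 'I_n.+1 -> Delta) (s : 'I_n.+1 -> system).

Definition nu_node : finType := {i : 'I_n.+1 & node (s i)}.

Definition nu_root (i : 'I_n.+1) : nu_node :=
  Tagged (fun i => node (s i)) (root (s i)).

Definition nu_link (z : Delta) : option nu_node :=
  if [pick i | y i == z] is Some i then Some (nu_root i) else None.

Definition nu_equation (p : nu_node) : label nu_node :=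
  map_label (fun q => Tagged (fun i => node (s i)) q : nu_node) nu_link
    (equation (tagged p)).

Definition nu_system : system := System (nu_root ord0) nu_equation.

Lemma card_nu_node : #|nu_node| = \sum_(i < n.+1) #|node (s i)|.
Proof. by rewrite card_tagged sumnE big_map big_enum. Qed.

Lemma update_link (C : coalgebra T) (V : Delta -> set C)
    (X : nu_node -> set C) (z : Delta) :
  update V y (X \o nu_root) z = if nu_link z is Some q then X q else V z.
Proof. by rewrite /update /nu_link; case: pickP. Qed.

(** Bekic's principle: the outer fixpoint over the bound variables and the inner ones over the nodes
    of the bodies merge into one simultaneous greatest fixpoint. *)
Lemma solution_nu (C : coalgebra T) (V : Delta -> set C)
    (phi : 'I_n.+1 -> formula L Delta) :
  (forall i (W : Delta -> set C),
     sem W (phi i) = solution W (@equation (s i)) (root (s i))) ->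
  gfp (fun A i => sem (update V y A) (phi i)) ord0
  = solution V nu_equation (nu_root ord0).
Proof.
move=> semE; set F := fun _ _ => _.
have mF A B : family_le A B -> family_le (F A) (F B).
  by move=> AB i; apply: sem_le => z _; apply: update_le => // _.
have [[gF _] maxF] := gfpP mF.
apply/seteqP; split=> x.
  (* Each body is solved with its bound variables fixed at [gfp F]; its root then has the value
     [gfp F], which is what the links demand. *)
  pose X (p : nu_node) : set C :=
    solution (update V y (gfp F)) (@equation (s (tag p))) (tagged p).
  have Xroot : X \o nu_root = gfp F.
    by apply/funext => i /=; rewrite -[in RHS]gF /F semE.
  move=> gx; exists X; last by rewrite -[X _]/((X \o nu_root) ord0) Xroot.
  move=> [i p] u /post_solution.
  by rewrite (label_sem_map (W := update V y (gfp F))) // -Xroot => z;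
    rewrite update_link.
(* Conversely, the values of [X] at the roots form a post-fixpoint of [F], since [X] restricts to a
   post-fixpoint of each body. *)
move=> [X pX Xx]; apply: (maxF (X \o nu_root)) Xx => i u Xu.
rewrite /F semE; exists (fun q => X (Tagged (fun i => node (s i)) q)) => //.
move=> q v /pX; rewrite (label_sem_map (W := update V y (X \o nu_root))) //.
exact: update_link.
Qed.

End NuSystem.

Fixpoint compile (f : formula L Delta) : system :=
  match f with
  | Top => single_system (Conj [::])
  | And f1 f2 => and_system (compile f1) (compile f2)
  | Prp a => single_system (Atom (OSPrp unit a))
  | Mod h f1 => mod_system h (compile f1)
  | Var y => single_system (Free y)
  | Nu n y _ phi => nu_system y (fun i => compile (phi i))
  end.

Lemma card_compile (f : formula L Delta) : #|node (compile f)| <= fsize f.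
Proof.
elim: f => [|f IHf g IHg|a|h f IHf|y|n y yi phi IH] /=; rewrite ?card_unit //.
- by rewrite card_option card_sum ltnS leq_add.
- by rewrite card_option ltnS.
- by rewrite card_nu_node leqW // leq_sum // => i _; apply: leqW.
Qed.

Lemma sem_compile (C : coalgebra T) (f : formula L Delta)
    (V : Delta -> set C) :
  sem V f = solution V (@equation (compile f)) (root (compile f)).
Proof.
elim: f V => [|f IHf g IHg|a|h f IHf|y|n y yi phi IH] V /=;
  last by apply: solution_nu.
all: rewrite solution_unfold //=.
- by apply/seteqP; split.
- rewrite IHf IHg.
  have El := solution_embed V (eQ := @and_equation (compile f) (compile g))
    (f := Some \o inl) (fun=> erefl).
  have Er := solution_embed V (eQ := @and_equation (compile f) (compile g))
    (f := Some \o inr) (fun=> erefl).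
  rewrite -El -Er /=; apply/seteqP; split=> x /=.
    by move=> [xf xg] p; rewrite !inE => /orP[] /eqP ->.
  by move=> xp; split; apply: xp; rewrite !inE eqxx ?orbT.
- rewrite IHf.
  by rewrite (solution_embed V (eQ := @mod_equation h (compile f)) (f := Some)
    (fun=> erefl)).
Qed.

End Systems.

(** * The wsi model of a system *)

Lemma os_sat_pmap (T : set_functor) (L : modal_signature T) (V : Type)
    (I : eqType) (M : one_step_model T V) (f : I -> option (one_step_atom L V))
    (s : seq I) :
  os_sat M (pmap f s) <->
  forall i a, i \in s -> f i = Some a -> os_sat_atom M a.
Proof.
elim: s => [|i s IHs] //=.
case fi: (f i) => [a|] /=; rewrite IHs; split.
- move=> [Ma Ms] j b; rewrite inE => /orP[/eqP->|/Ms]; last exact.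
  by rewrite fi => -[<-].
- move=> Ms; split; first by apply: Ms fi; rewrite mem_head.
  by move=> j b js; apply: Ms; rewrite inE js orbT.
- move=> Ms j b; rewrite inE => /orP[/eqP->|/Ms]; last exact.
  by rewrite fi.
- by move=> Ms j b js; apply: Ms; rewrite inE js orbT.
Qed.

(** An injection of [A] into ['I_k] assigns slots, and empty slots hold [None]. The extra slot keeps
    the index type inhabited, so that singletons are representable even for [k = 0]. *)
Lemma card_le_codom (P : finType) (k : nat) (A : set P) :
  (A #<= `I_k)%card ->
  exists U : {ffun 'I_k.+1 -> option P}, forall p, A p <-> Some p \in codom U.
Proof.
move=> /pcard_leP[g]; have gA := 'funS_g; have gI := 'inj_g.
exists [ffun i : 'I_k.+1 => [pick p | `[< A p >] && (g p == i)]] => p; split.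
  move=> Ap; apply/codomP; exists (inord (g p)); rewrite ffunE.
  have gp : g p < k.+1 by apply: ltnW; apply: gA.
  case: pickP => [q|/(_ p)]; last by rewrite asboolT //= inordK // eqxx.
  rewrite inordK // => /andP[/asboolP Aq /eqP gqp].
  by congr Some; apply: gI; rewrite ?inE.
case/codomP=> i; rewrite ffunE; case: pickP => // q /andP[/asboolP Aq _].
by move=> [->].
Qed.

Lemma card_setT_le (F : finType) (m : nat) :
  #|F| <= m -> ([set: F] #<= `I_m)%card.
Proof.
move=> Fm; pose f (x : F) : nat := enum_rank x.
have fI : injective f by move=> x y /ord_inj/enum_rank_inj.
have /card_eqPle[_ le_f] := inj_card_eq (in2W fI : {in [set: F] &, injective f}).
apply: card_le_trans le_f _; apply: subset_card_le => _ [x _ <-] /=.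
exact: leq_trans (ltn_ord _) Fm.
Qed.

Section Model.
Variables (T : set_functor) (L : modal_signature T) (Delta : eqType) (k : nat).
Hypothesis bounded : admits_bounded_one_step_wsi L k.
Variable s : system L Delta.

Notation P := (node s).

(* A state represents the set of the nodes it takes as values. *)
Definition state_type : finType := {ffun 'I_k.+1 -> option P}.

Definition link (p q : P) : bool :=
  if equation p is Conj r then q \in r else false.

Definition reach (U : state_type) (q : P) : bool :=
  [exists p, (Some p \in codom U) && connect link p q].

(** Only atoms are collected. A [Free] node contributes nothing, which amounts to valuing it by
    [setT]; a cycle of links contributes no atom either, in accordance with greatest fixpoints. *)
Definition state_formula (U : state_type) : one_step_formula L P :=
  pmap (fun p => if equation p is Atom a then Some a else None)
    (enum (reach U)).

Lemma os_sat_state_formula (U : state_type) (M : one_step_model T P) :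
  os_sat M (state_formula U) <->
  forall p a, reach U p -> equation p = Atom _ a -> os_sat_atom M a.
Proof.
rewrite os_sat_pmap; split=> Ms p a.
  by move=> Up pa; apply: (Ms p); rewrite ?mem_enum ?pa.
by rewrite mem_enum => Up; case E: (equation p) => [|b|] // [<-]; apply: Ms E.
Qed.

Definition type_state (M : one_step_model T P) (g : M -> state_type) : Prop :=
  forall x p, os_type x p <-> Some p \in codom (g x).

Definition is_transition (xi : state_type -> T state_type) : Prop :=
  forall U, exists (M : one_step_model T P) (g : M -> state_type),
    [/\ one_step_wsi M (state_formula U), type_state g
      & xi U = fmap T g (os_elt M)].

Lemma transition_exists : exists xi, is_transition xi.
Proof.
suff /choice[xi xiP] : forall U, exists t,
    exists (M : one_step_model T P) (g : M -> state_type),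
    [/\ one_step_wsi M (state_formula U), type_state g
      & t = fmap T g (os_elt M)] by exists xi.
move=> U; have [M [wsiM /= bM]] := bounded (state_formula U).
have /choice[g gP] := fun x => card_le_codom (bM x).
by exists (fmap T g (os_elt M)), M, g.
Qed.

(** * Simulations versus post-fixpoints *)

Section Wsi.
Variable xi : state_type -> T state_type.
Hypothesis xiP : is_transition xi.

Let C : coalgebra T := Coalgebra xi.

Lemma post_simulation (D : coalgebra T) (X : P -> set D) (V : Delta -> set D) :
  post V (@equation _ _ _ s) X ->
  simulation L
    (fun (U : C) (y : D) => forall p, Some p \in codom U -> X p y).
Proof.
move=> pX U y UX.
(* Membership of [y] propagates along links, by induction on the path. *)
have rX q : reach U q -> X q y.
  case/existsP=> p /andP[/UX Xp /connectP[r]].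
  elim: r p Xp => [|p' r IHr] p Xp /=; first by move=> _ ->.
  move=> /andP[pp' rP] qE; apply: IHr rP qE.
  move: pp' (pX _ _ Xp); rewrite /link; case: (equation p) => // l p'l.
  exact.
have [M [g [[_ wsiM] gT xiE]]] := xiP U.
(* [X] and the transition of [y] form a one-step model of the formula of [U], to which the one-step
   wsi property of [M] applies; naturality of the liftings along [g] carries the result over to
   states. *)
have /wsiM[simM simA] : os_sat (OneStepModel X (transition y)) (state_formula U).
  apply/os_sat_state_formula => p a /rX Xp pa.
  by have := pX _ _ Xp; rewrite pa.
split=> [h A|a] /=; rewrite xiE => hA; last first.
  by apply: simA; rewrite (prop_lifting_natural a g).
apply: (lifting_monotone _ (simM h (g @^-1` A) _)).
  move=> z [x Ax xz]; exists (g x) => // p /gT; exact: xz.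
by rewrite lifting_natural.
Qed.

(** Conjunctions hold by transitivity of reachability, atoms because [M] satisfies the formula of
    [U] and [S] preserves liftings. *)
Lemma simulation_post (D : coalgebra T) (S : C -> D -> Prop) :
  simulation L S ->
  post (fun=> setT) (@equation _ _ _ s)
    (fun p => [set y | exists2 U : C, S U y & reach U p]).
Proof.
move=> simS p y [U Uy Up].
have [simM simA] := simS _ _ Uy.
have [M [g [[satM _] gT xiE]]] := xiP U.
case pE: (equation p) => [r|a|z] //=.
  move=> q qr; exists U => //; case/existsP: Up => p' /andP[p'U p'p].
  apply/existsP; exists p'; rewrite p'U; apply: connect_trans p'p (connect1 _).
  by rewrite /link pE.
have := (os_sat_state_formula _ _).1 satM p a Up pE.
case: a {pE} => [a|h q] /= sat_a.
  by apply: simA; rewrite /= xiE -[prop_lifting _ _ _]/((fmap T g @^-1` _) _)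
    -(prop_lifting_natural a g).
(* The preimage under [g] of the states containing [q] is the valuation of [q] in [M]. *)
have /simM : lifting h [set U' : C | Some q \in codom U'] (transition U).
  rewrite /= xiE -[lifting _ _ _]/((fmap T g @^-1` _) _) -lifting_natural.
  by apply: lifting_monotone sat_a => x /gT.
apply: lifting_monotone => z [U' qU' U'z]; exists U' => //.
by apply/existsP; exists q; rewrite qU' connect0.
Qed.

Lemma solution_simulation (D : coalgebra T) (y : D) (p : P) :
  solution (fun=> setT) (@equation _ _ _ s) p y <->
  exists S : C -> D -> Prop,
    simulation L S /\ S ([ffun=> Some p] : state_type) y.
Proof.
split=> [[X pX Xy]|[S [simS Sy]]].
  exists (fun (U : C) y => forall p, Some p \in codom U -> X p y).
  split; first exact: post_simulation pX.
  by move=> q /codomP[i]; rewrite ffunE => -[->].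
exists (fun p => [set y | exists2 U : C, S U y & reach U p]).
  exact: simulation_post.
exists ([ffun=> Some p] : state_type) => //.
apply/existsP; exists p; rewrite connect0 andbT.
by apply/codomP; exists ord0; rewrite ffunE.
Qed.

End Wsi.
End Model.

Theorem theorem6p6 (T : set_functor) (L : modal_signature T) (Delta : eqType)
    (T_nontrivial : nontrivial T) (T_subsets : preserves_subsets T)
    (L_bounded : exists k : nat, admits_bounded_one_step_wsi L k) :
  exists p : {poly nat},
    forall phi : formula L Delta, sentence phi ->
      exists (C : coalgebra T) (r : C),
        wsi r phi /\ ([set: C] #<= `I_(p.[fsize phi])%R)%card.
Proof.
(* With N nodes there are (N + 1)^(k + 1) functions from ['I_k.+1] to [option] of the nodes, and N
   is at most [fsize phi]. *)
have [k bounded] := L_bounded; exists (('X + 1%:P) ^+ k.+1)%R => phi phi0.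
have [xi xiP] := transition_exists bounded (compile phi).
exists (Coalgebra xi), ([ffun=> Some (root (compile phi))] : state_type _ _).
split.
  (* A sentence may be evaluated under any valuation; [setT] is the one for which simulations yield
     post-fixpoints. *)
  move=> D y; rewrite /satisfies (sem_sentence _ (fun=> setT) phi0) sem_compile.
  exact: solution_simulation.
apply: card_setT_le.
rewrite card_ffun card_option card_ord horner_exp hornerD hornerX hornerC.
by rewrite -[X in _ <= X]natrXE natrDE addn1 leq_exp2r ?ltnS ?card_compile.
Qed.
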